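(* Let $\mathfrak g$ be a hermitian simple Lie algebra of tube type with $H$-element $H_0$ and associated Cartan involution $\theta$, let $\kappa:(\mathfrak{sl}(2,\mathbb R),\tfrac12 U)\to(\mathfrak g,H_0)$ be an $(H_1)$-homomorphism of multiplicity $1$, and put $H_\kappa=\kappa(H)$, $\mathfrak b_\kappa=\mathfrak g_0(H_\kappa)+\mathfrak g_1(H_\kappa)+\mathfrak g_2(H_\kappa)$ and $\mathfrak g_\kappa=\mathfrak z_{\mathfrak g}(\operatorname{im}\kappa)$. Suppose that $\mathfrak g_\kappa$ is hermitian simple and of tube type, and let $h_\kappa\in\mathfrak g_\kappa^{-\theta}=[H_0,\mathfrak g_\kappa]$ be a non-trivial Euler element of $\mathfrak g_\kappa$. Then $h:=\tfrac12 H_\kappa+h_\kappa\in\mathfrak b_\kappa$ is an Euler element of $\mathfrak g$ and of $\mathfrak b_\kappa$, and we have $\mathfrak g_1(h)=(\mathfrak b_\kappa)_1(h)$ and $h\in\mathfrak g^{-\theta}$.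
   Context: All Lie algebras are real and finite-dimensional. A simple non-compact Lie algebra is hermitian if its maximal compactly embedded subalgebras have non-trivial center; it is of tube type if the associated hermitian symmetric space is of tube type (equivalently, if it contains a non-zero Euler element). For $x\in\mathfrak g$ and an $\operatorname{ad}x$-invariant subspace $E$, $E_\lambda(x)=\ker(\operatorname{ad}x-\lambda\,\mathrm{id})\cap E$. An element $h$ of a Lie algebra $\mathfrak q$ is an Euler element if $\operatorname{ad}_{\mathfrak q}h$ is diagonalizable with spectrum contained in $\{-1,0,1\}$. An $H$-element of $\mathfrak g$ is an element $H_0$ such that $\ker(\operatorname{ad}H_0)$ is a maximal compactly embedded subalgebra and $\operatorname{ad}H_0$ is semisimple on $\mathfrak g_{\mathbb C}$ with spectrum $\{0,i,-i\}$. The Cartan involution $\theta$ is the one with $\mathfrak g^\theta=\ker(\operatorname{ad}H_0)$; $\mathfrak g^{-\theta}=\{x:\theta(x)=-x\}$. An $(H_1)$-homomorphism $\kappa:(\mathfrak g_1,H_0)\to(\mathfrak g_2,H_0')$ is a Lie algebra homomorphism with $\kappa\circ\operatorname{ad}H_0=\operatorname{ad}H_0'\circ\kappa$. In $\mathfrak{sl}(2,\mathbb R)$: $H=\begin{pmatrix}1&0\\0&-1\end{pmatrix}$, $X=\begin{pmatrix}0&1\\0&0\end{pmatrix}$, $Y=\begin{pmatrix}0&0\\1&0\end{pmatrix}$, $U=\begin{pmatrix}0&1\\-1&0\end{pmatrix}$. For an $(H_1)$-homomorphism $\kappa:(\mathfrak{sl}(2,\mathbb R),\frac12U)\to(\mathfrak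 g,H_0)$, $\operatorname{ad}H_\kappa$ is diagonalizable with eigenvalues in $\{-2,-1,0,1,2\}$; $\kappa$ is of multiplicity $1$ if $\dim\mathfrak g_{\pm2}(H_\kappa)=1$. $\mathfrak z_{\mathfrak g}(\cdot)$ denotes the centralizer. *)

(* Defs.v *)
From HB Require Import structures.
From mathcomp Require Import all_boot all_order all_algebra.
From mathcomp Require Import complex ring.
From mathcomp Require Import boolp classical_sets functions reals.
From mathcomp Require Import topology normedtype sequences.

Set Implicit Arguments.
Unset Strict Implicit.
Unset Printing Implicit Defensive.

Import Order.TTheory GRing.Theory Num.Theory.
Import numFieldNormedType.Exports.

Local Open Scope classical_set_scope.
Local Open Scope ring_scope.

HB.mixin Record Vector_isLieAlgebra (F : fieldType) V of Vector F V := {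
  lie : V -> V -> V;
  lie_linearl : forall y, linear (lie^~ y);
  lie_linearr : forall x, linear (lie x);
  liexx : forall x, lie x x = 0;
  lie_jacobi : forall x y z,
    lie x (lie y z) + lie y (lie z x) + lie z (lie x y) = 0
}.

#[short(type="lieAlgType")]
HB.structure Definition LieAlgebra (F : fieldType) :=
  {V of Vector_isLieAlgebra F V & Vector F V}.

Section LieBasics.
Context {F : fieldType} {g : lieAlgType F}.
Implicit Types (x y z : g) (U : {vspace g}).

HB.instance Definition _ x :=
  GRing.isSemilinear.Build F g g _ (lie x)
    (GRing.semilinear_linear (lie_linearr x)).

Definition ad x : 'End(g) := linfun (lie x).

Lemma adE x y : ad x y = lie x y.
Proof. by rewrite lfunE. Qed.

Lemma lieC x y : lie x y = - lie y x.
Proof.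
have lieDl u v w : lie (u + v) w = lie u w + lie v w.
  by rewrite -[u in LHS]scale1r lie_linearl scale1r.
apply/eqP; rewrite -addr_eq0; apply/eqP.
by have := liexx (x + y); rewrite lieDl !linearD /= !liexx add0r addr0.
Qed.

Lemma lie_jacobir x y z : lie x (lie y z) = lie (lie x y) z + lie y (lie x z).
Proof.
have := lie_jacobi x y z; rewrite [lie z (lie x y)]lieC [lie z x]lieC linearN.
by move/eqP; rewrite -addrA -opprD subr_eq0 [X in _ == X -> _]addrC => /eqP.
Qed.

Definition lie_closed U := forall x y, x \in U -> y \in U -> lie x y \in U.

Definition ideal U := forall x y, y \in U -> lie x y \in U.

Definition simple_lie :=
  (exists x y, lie x y != 0) /\
  (forall U, ideal U -> U = 0%VS \/ U = fullv).

Definition eigsp (a : F) x : {vspace g} := lker (ad x - a *: \1%VF).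

Definition centv U : {vspace g} := (\bigcap_(i < \dim U) lker (ad (vbasis U)`_i))%VS.

Lemma centvP U x :
  reflect (forall u, u \in U -> lie u x = 0) (x \in centv U).
Proof.
rewrite /centv; apply: (iffP idP) => [xC u uU|xC].
  rewrite (coord_vbasis uU).
  have -> : lie (\sum_i coord (vbasis U) i u *: (vbasis U)`_i) x
      = \sum_i coord (vbasis U) i u *: lie (vbasis U)`_i x.
    rewrite lieC linear_sum -sumrN; apply: eq_bigr => i _.
    by rewrite linearZ -scalerN -lieC.
  rewrite big1 // => i _; rewrite -adE.
  suff : x \in lker (ad (vbasis U)`_i).
    by rewrite memv_ker => /eqP ->; rewrite scaler0.
  by apply: (subvP _ _ xC); apply: (bigcapv_inf i).
rewrite memvE; apply/subv_bigcapP => i _.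
by rewrite -memvE memv_ker adE xC // vbasis_mem // mem_nth // size_tuple.
Qed.

Lemma centv_closed U : lie_closed (centv U).
Proof.
move=> x y /centvP xC /centvP yC; apply/centvP => u uU.
by rewrite lie_jacobir (xC u) // (yC u) // lieC !linear0 addr0.
Qed.

End LieBasics.
Arguments simple_lie {F} g.

Record lie_subalgebra (F : fieldType) (g : lieAlgType F) := LieSubalgebra {
  lsval :> {vspace g};
  lsvalP : lie_closed lsval
}.

Section Subalgebra.
Context {F : fieldType} {g : lieAlgType F} (L : lie_subalgebra g).

Definition sub_lie (x y : subvs_of L) : subvs_of L :=
  Subvs (lsvalP (subvsP x) (subvsP y)).

Fact sub_lie_linearl y : linear (sub_lie^~ y).
Proof. by move=> a u v; apply: val_inj; rewrite /= lie_linearl. Qed.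

Fact sub_lie_linearr x : linear (sub_lie x).
Proof. by move=> a u v; apply: val_inj; rewrite /= lie_linearr. Qed.

Fact sub_liexx x : sub_lie x x = 0.
Proof. by apply: val_inj; rewrite /= liexx. Qed.

Fact sub_lie_jacobi x y z :
  sub_lie x (sub_lie y z) + sub_lie y (sub_lie z x) + sub_lie z (sub_lie x y)
  = 0.
Proof. by apply: val_inj; rewrite /= lie_jacobi. Qed.

HB.instance Definition _ := Vector_isLieAlgebra.Build F (subvs_of L)
  sub_lie_linearl sub_lie_linearr sub_liexx sub_lie_jacobi.

End Subalgebra.

Definition centralizer (F : fieldType) (g : lieAlgType F) (U : {vspace g}) :
  lie_subalgebra g := LieSubalgebra (@centv_closed F g U).

Section Morphisms.
Context {F : fieldType}.

Definition lie_hom (g1 g2 : lieAlgType F) (f : 'Hom(g1, g2)) :=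
  forall x y, f (lie x y) = lie (f x) (f y).

Definition lie_aut (g : lieAlgType F) (f : 'End(g)) :=
  lie_hom f /\ bijective f.

Definition H1_hom (g1 g2 : lieAlgType F) (f : 'Hom(g1, g2)) (H1 : g1) (H2 : g2)
  := lie_hom f /\ (f \o ad H1 = ad H2 \o f)%VF.

End Morphisms.

(* The matrix of f in the basis vbasis {:V}, acting on row vectors. *)
Definition mxend (F : fieldType) (V : vectType F) (f : 'End(V)) :
  'M[F]_(\dim {:V}) := passmx.mxof (vbasis {:V}) (vbasis {:V}) f.

Definition killing (F : fieldType) (g : lieAlgType F) (x y : g) : F :=
  \tr (mxend (ad x \o ad y)%VF).

Definition euler (F : fieldType) (g : lieAlgType F) (h : g) :=
  diagonalizable (mxend (ad h)) /\
  {subset eigenvalue (mxend (ad h)) <= [:: -1; 0; 1]}.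

Section GeneralLinear.
Context {F : fieldType} {n : nat}.
Implicit Types A B C : 'M[F]_n.

Definition mx_lie A B := A *m B - B *m A.

Fact mx_lie_linearl B : linear (mx_lie^~ B).
Proof.
move=> a A C; rewrite /mx_lie mulmxDl mulmxDr -scalemxAl -scalemxAr scalerBr.
by rewrite opprD addrACA.
Qed.

Fact mx_lie_linearr A : linear (mx_lie A).
Proof.
move=> a B C; rewrite /mx_lie mulmxDl mulmxDr -scalemxAl -scalemxAr scalerBr.
by rewrite opprD addrACA.
Qed.

Fact mx_liexx A : mx_lie A A = 0.
Proof. exact: subrr. Qed.

Fact mx_lie_jacobi A B C :
  mx_lie A (mx_lie B C) + mx_lie B (mx_lie C A) + mx_lie C (mx_lie A B) = 0.
Proof.
rewrite /mx_lie !mulmxBl !mulmxBr !mulmxA.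
move: (A *m B *m C) (A *m C *m B) (B *m C *m A) (C *m B *m A) (B *m A *m C).
move: (C *m A *m B) => p q r s t u.
by apply/matrixP => i j; rewrite !mxE; ring.
Qed.

HB.instance Definition _ := Vector_isLieAlgebra.Build F 'M[F]_n
  mx_lie_linearl mx_lie_linearr mx_liexx mx_lie_jacobi.

End GeneralLinear.

Section SpecialLinear.
Variable F : fieldType.

Definition sl2_space : {vspace 'M[F]_2} :=
  lker (linfun (mxtrace : 'M[F]_2 -> F^o)).

Lemma sl2P (A : 'M[F]_2) : (A \in sl2_space) = (\tr A == 0).
Proof. by rewrite memv_ker lfunE. Qed.

Fact sl2_closed : lie_closed sl2_space.
Proof. by move=> A B _ _; rewrite sl2P raddfB /= mxtrace_mulC subrr. Qed.

Definition sl2 : lie_subalgebra 'M[F]_2 := LieSubalgebra sl2_closed.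

Definition mx22 (a b c d : F) : 'M[F]_2 :=
  \matrix_(i, j) nth 0 (nth [::] [:: [:: a; b]; [:: c; d]] i) j.

Fact sl2_H_proof : mx22 1 0 0 (-1) \in sl2.
Proof. by rewrite sl2P /mxtrace !big_ord_recl big_ord0 !mxE /= addr0 subrr. Qed.

Fact sl2_U_proof : mx22 0 1 (-1) 0 \in sl2.
Proof. by rewrite sl2P /mxtrace !big_ord_recl big_ord0 !mxE /= !addr0. Qed.

Definition sl2_H : subvs_of sl2 := Subvs sl2_H_proof.
Definition sl2_U : subvs_of sl2 := Subvs sl2_U_proof.

End SpecialLinear.

Section RealLie.
Context {R : realType}.

Definition expmx n (A : 'M[R]_n) : 'M[R]_n :=
  limn (series (fun k => (k`!%:R)^-1 *: A ^+ k)).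

Section Compactness.
Context {g : lieAlgType R}.
Implicit Types k : {vspace g}.

(* The subgroup of Aut(g) generated by the exponentials of ad x, x in k. *)
Inductive inner_group k : set 'M[R]_(\dim {:g}) :=
| inner_exp x of x \in k : inner_group k (expmx (mxend (ad x)))
| inner_mul A B of inner_group k A & inner_group k B : inner_group k (A *m B)
| inner_inv A of inner_group k A : inner_group k (invmx A).

Definition aut_group : set 'M[R]_(\dim {:g}) :=
  [set mxend f | f in @lie_aut R g].

(* The closure is taken in Aut(g), whence the intersection. *)
Definition compactly_embedded k :=
  lie_closed k /\ compact (closure (inner_group k) `&` aut_group).

Definition max_compactly_embedded k :=
  compactly_embedded k /\
  (forall k', compactly_embedded k' -> (k <= k')%VS -> k' = k).

Definition center_of k : {vspace g} := (k :&: centv k)%VS.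

End Compactness.

Definition hermitian_simple (g : lieAlgType R) :=
  [/\ simple_lie g,
      ~ compactly_embedded (fullv : {vspace g}) &
      forall k : {vspace g}, max_compactly_embedded k -> center_of k != 0%VS].

(* For hermitian simple g, this is the Lie algebraic characterization of the
   associated hermitian symmetric space being of tube type. *)
Definition tube_type (g : lieAlgType R) := exists2 h : g, h != 0 & euler h.

Definition H_element (g : lieAlgType R) (H0 : g) :=
  let M := map_mx (real_complex R) (mxend (ad H0)) in
  [/\ max_compactly_embedded (lker (ad H0)),
      diagonalizable M &
      eigenvalue M =i [:: 0; 'i%C; - 'i%C]].

Definition cartan_involution (g : lieAlgType R) (theta : 'End(g)) :=
  [/\ lie_hom theta,
      (theta \o theta)%VF = \1%VF &
      forall x, x != 0 -> 0 < - killing x (theta x)].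

End RealLie.

Definition antifixed_sp (F : fieldType) (g : lieAlgType F) (theta : 'End(g)) :
  {vspace g} := lker (theta + \1%VF).

Definition multiplicity_one (F : fieldType) (g : lieAlgType F)
    (kappa : 'Hom(subvs_of (sl2 F), g)) :=
  \dim (eigsp 2 (kappa (sl2_H F))) = 1%N /\
  \dim (eigsp (-2) (kappa (sl2_H F))) = 1%N.

(* Main.v *)
(* Write D = ad H0, e = kappa X, f = kappa Y, u = kappa (U/2) = (e - f)/2 and
   z = H0 - u, which centralizes the image of kappa.  Since D^3 = - D and D
   rotates the plane spanned by H = kappa H and e + f, the operator ad H is
   killed by t(t^2 - 1)(t^2 - 4), so g is the sum of the eigenspaces g_k(H),
   -2 <= k <= 2; multiplicity one makes g_2 and g_(-2) the lines spanned by e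
   and f, and g_0 = R H + g_kappa.
   In g_kappa, z acts as H0 does and [z, [z, h_kappa]] = - h_kappa.  The
   h_kappa-weight +-1 parts of z span an sl2-triple with h_kappa, and the
   weight 0 part of z commutes with it; since z has eigenvalues 0, i, -i, that
   part kills the h_kappa-weight +-1 spaces of g_kappa, so it is zero by
   simplicity and [h_kappa, [h_kappa, z]] = z.  On g_1(H) and g_(-1)(H) the
   relation D^3 = - D forces z^2 = -1/4, and then z and h_kappa anticommute
   there and h_kappa^2 = 1/4.  Hence h = H/2 + h_kappa has eigenvalues 0, 1 on
   g_1(H), and 0, -1 on g_(-1)(H), and +-1 on g_(+-2)(H). *)
Require Import Defs.
From HB Require Import structures.
From mathcomp Require Import all_boot all_order all_algebra.
From mathcomp Require Import complex ring lra.
From mathcomp Require Import boolp classical_sets functions reals.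
From mathcomp Require Import topology normedtype sequences.
Set Implicit Arguments.
Unset Strict Implicit.
Unset Printing Implicit Defensive.
Import Order.TTheory GRing.Theory Num.Theory.
Import passmx.
Local Open Scope ring_scope.


(** * Spectral conditions as cubic identities *)

(** The eigenspaces sum to the whole space, and each lies in the kernel of A^3 - cA. Euler elements
    use c = 1, H-elements c = -1. *)
Lemma diagonalizable_cube (F : fieldType) n (A : 'M[F]_n) (c : F) :
  diagonalizable A -> (forall a, eigenvalue A a -> a ^+ 3 = c * a) ->
  A *m A *m A = c *: A.
Proof.
move=> /diagonalizablePeigen [rs _ rsE] cube.
suff : (1%:M <= kermx (A *m A *m A - c *: A))%MS.
  by rewrite sub_kermx mul1mx subr_eq0 => /eqP.
rewrite -rsE; elim/big_ind: _ => [|U V sU sV|a _]; first exact: sub0mx.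
  by rewrite addsmx_sub sU.
have [->|ane0] := eqVneq (eigenspace A a) 0; first exact: sub0mx.
have /eigenspaceP AE : (eigenspace A a <= eigenspace A a)%MS by [].
rewrite sub_kermx mulmxBr !mulmxA AE -!scalemxAl AE -!scalemxAl AE -scalemxAr.
by rewrite AE !scalerA -cube // !exprS expr0 mulr1 mulrA subrr.
Qed.

(** The minimal polynomial divides (X + 1)X(X - 1), whose roots are distinct in characteristic 0. *)
Lemma cube_diagonalizable (F : numFieldType) n (A : 'M[F]_n) :
  A *m A *m A = A ->
  diagonalizable A /\ {subset eigenvalue A <= [:: -1; 0; 1]}.
Proof.
move=> A3; split; last first.
  move=> a /eigenvalueP [v vA vn0]; rewrite !inE.
  have : (a * a * a - a) *: v == 0.
    rewrite scalerBl -vA -[in v *m A]A3 !mulmxA.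
    by rewrite vA -!scalemxAl vA -!scalemxAl vA !scalerA subrr.
  rewrite scaler_eq0 (negPf vn0) orbF.
  have -> : a * a * a - a = (a + 1) * (a * (a - 1)) by ring.
  by rewrite !mulf_eq0 addr_eq0 subr_eq0.
case: n A A3 => [|n] A A3; first by rewrite [A]thinmx0; apply: diagonalizable0.
apply/diagonalizableP; exists [:: -1; 0; 1].
  have n10 : (-1 : F) < 0 by rewrite oppr_lt0 ltr01.
  have n11 : (-1 : F) < 1 by rewrite (lt_trans n10) ?ltr01.
  by rewrite /= !inE negb_or (lt_eqF n10) (lt_eqF n11) (lt_eqF (@ltr01 F)).
apply: mxminpoly_min; rewrite !big_cons big_nil mulr1.
have -> : ('X - (-1)%:P) * (('X - 0%:P) * ('X - 1%:P)) = 'X * 'X * 'X - 'X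
  :> {poly F} by rewrite polyCN polyC0 polyC1; ring.
by rewrite rmorphB !rmorphM /= horner_mx_X (A3 : A * A * A = A) subrr.
Qed.

Lemma mxend_cubeE (F : fieldType) (V : vectType F) (f : 'End(V)) (c : F) :
  mxend f *m mxend f *m mxend f = c *: mxend f <->
  forall x, f (f (f x)) = c *: f x.
Proof.
have bV : basis_of {:V} (vbasis {:V}) by exact: vbasisP.
have -> : c *: mxend f = mxend (c *: f) by rewrite /mxend linearZ.
rewrite /mxend -!mxof_comp //.
split=> [/(can_inj (mxofK bV bV)) E x|E].
  by have /lfunP/(_ x) := E; rewrite !lfunE /= !lfunE.
by apply: (congr1 (mxof _ _)); apply/lfunP => x; rewrite !lfunE /= !lfunE /= E.
Qed.

Lemma eulerP (F : numFieldType) (g : lieAlgType F) (h : g) :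
  euler h <-> forall x, lie h (lie h (lie h x)) = lie h x.
Proof.
split=> [[diag spec] x|h3].
  have : mxend (ad h) *m mxend (ad h) *m mxend (ad h) = 1 *: mxend (ad h).
    apply: diagonalizable_cube => // a /spec; rewrite !inE.
    by case/or3P => /eqP ->; ring.
  by rewrite mxend_cubeE => /(_ x); rewrite scale1r !adE.
apply: cube_diagonalizable; rewrite -[RHS]scale1r.
by apply/mxend_cubeE => x; rewrite scale1r !adE h3.
Qed.

Lemma H_element_cube (R : realType) (g : lieAlgType R) (H0 : g) :
  H_element H0 -> forall x, lie H0 (lie H0 (lie H0 x)) = - lie H0 x.
Proof.
move=> [_ diag spec] x.
have : mxend (ad H0) *m mxend (ad H0) *m mxend (ad H0) = (-1) *: mxend (ad H0).
  (* The identity is checked over the complex numbers, where 0, i and -i satisfy a^3 = -a, and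
     descends by injectivity. *)
  apply: (map_mx_inj (f := real_complex R)).
  rewrite !map_mxM /= map_mxZ rmorphN1; apply: diagonalizable_cube => // a ea.
  have ii : 'i%C * 'i%C = -1 :> R[i] by rewrite -expr2 sqr_i.
  have -> : a ^+ 3 = a * (a * a) by ring.
  have : a \in [:: 0; 'i%C; - 'i%C] by rewrite -spec.
  by rewrite !inE => /or3P [] /eqP ->; rewrite ?mulrNN ?ii; ring.
by rewrite mxend_cubeE => /(_ x); rewrite scaleN1r !adE.
Qed.


(** Coordinates separate points. Linearity of [c] is passed as hypotheses so that [c] can stay
    opaque when used for rewriting. *)
Lemma functional_ext (F : fieldType) (V : vectType F) (x y : V) :
  (forall c : V -> F, (forall u v, c (u + v) = c u + c v) ->
     (forall a u, c (a *: u) = a * c u) -> (forall u, c (- u) = - c u) ->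
     c 0 = 0 -> c x = c y) -> x = y.
Proof.
move=> cE; rewrite (coord_vbasis (memvf x)) (coord_vbasis (memvf y)).
apply: eq_bigr => i _; congr (_ *: _); apply: cE => [u v|a u|u|].
- exact: linearD.
- exact: linearZ.
- exact: linearN.
- exact: linear0.
Qed.

(* Closes an equation between vectors that is a linear combination of the
   vector equations in the context, by testing against linear functionals. *)
Ltac vlra :=
  intros; apply: functional_ext;
  let c := fresh "c" in let cD := fresh in let cZ := fresh in
  let cN := fresh in let c0 := fresh in
  move=> c cD cZ cN c0;
  repeat match goal with
  | E : _ = _ |- _ =>
    apply (congr1 c) in E; rewrite ?(cD, cZ, cN, c0) in E; move: E
  end;
  rewrite ?(cD, cZ, cN, c0); clear cD cZ cN c0; intros; lra.

(** * The quintic relation for ad H *)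

Section Rotation.
Context {R : realFieldType} {V : vectType R} (D K B u : {linear V -> V}).
Hypothesis D3 : forall x, D (D (D x)) = - D x.
Hypothesis DK : forall x, D (K x) - K (D x) = - B x.
Hypothesis DB : forall x, D (B x) - B (D x) = K x.
Hypothesis KB : forall x, K (B x) - B (K x) = 4 *: u x.
Hypothesis uK : forall x, u (K x) - K (u x) = - B x.


Let lin := (linearD, linearB, linearN, linearZ, linear0).

(** This is the double commutator [D, [D, K]] = -K, free of [B]. *)
Let DDK x : D (D (K x)) - 2 *: D (K (D x)) + K (D (D x)) = - K x.
Proof.
have E1 := congr1 D (DK x); rewrite !lin /= in E1.
by have E2 := DB x; have E3 := DK (D x); vlra.
Qed.

(** V is ker D + im D, with im D described by D^2 = -1. Evaluating [DDK] at y and D y gives D^2 K y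
    = 2 D K D y and D^2 K D y = -2 D K y, so -D K y = D^3 K y = -4 D K y. *)
Lemma K_im y : D (D y) = - y -> D (K y) = 0.
Proof.
move=> py; have E1 := DDK y; have E2 := DDK (D y).
have := congr1 D E1; rewrite py !lin /= !D3 in E1 E2 * => E3; vlra.
Qed.

Lemma K_ker x : D x = 0 -> D (D (K x)) = - K x.
Proof. by move=> kx; have E := DDK x; rewrite kx !lin in E; vlra. Qed.

Let B_ker x : D x = 0 -> B x = - D (K x).
Proof. by move=> kx; have E := DK x; rewrite kx !lin in E; vlra. Qed.

Let B_im y : D (D y) = - y -> B y = K (D y).
Proof. by move=> py; have E := DK y; rewrite K_im // in E; vlra. Qed.

(** This is [K, [K, B]] = 4 B on im D, with B replaced by K D on im D and by -D K on ker D; K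
    exchanges the two summands. *)
Let im_eq y : D (D y) = - y ->
  K (K (K y)) - 3 *: K (D (K (K (D y)))) = 4 *: K y.
Proof.
move=> py.
(* The commutator yields the identity at D y; substituting D y for y and using D^2 = -1 leads back
   to y. *)
suff {y py} main y : D (D y) = - y ->
    K (K (K (D y))) + 3 *: K (D (K (K y))) = 4 *: K (D y).
  by have := main (D y); rewrite py !lin /= => /(_ erefl) E; vlra.
move=> py; have kKy := K_im py.
have E1 := KB (K y); have E2 := congr1 K (KB y); have E3 := uK y.
rewrite (B_ker kKy) (B_im (K_ker kKy)) (B_im py) !lin in E1 E2 E3.
by vlra.
Qed.

Let ker_eq x : D x = 0 ->
  K (K (K x)) - 3 *: D (K (K (D (K x)))) = 4 *: K x.
Proof.
move=> kx; have pKx := K_ker kx; have pKKKx := K_ker (K_im pKx).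
have pDKx : D (D (D (K x))) = - D (K x) by rewrite D3.
have E1 := KB (K x); have E2 := congr1 K (KB x); have E3 := uK x.
rewrite (B_im pKx) (B_ker kx) (B_ker (K_im pKx)) !lin in E1 E2 E3.
have E : 3 *: K (K (D (K x))) + D (K (K (K x))) = 4 *: D (K x) by vlra.
have {E} := congr1 D E; rewrite !lin /= pKx pKKKx => E.
by vlra.
Qed.

Lemma rotation_quintic x :
  K (K (K (K (K x)))) = 5 *: K (K (K x)) - 4 *: K x.
Proof.
suff [kerE imE] : (forall x, D x = 0 ->
    K (K (K (K (K x)))) = 5 *: K (K (K x)) - 4 *: K x) /\
    (forall y, D (D y) = - y ->
    K (K (K (K (K y)))) = 5 *: K (K (K y)) - 4 *: K y).
  have xE : x = (x + D (D x)) + D (- D x) by rewrite linearN /= addrK.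
  have := kerE (x + D (D x)); rewrite linearD /= D3 subrr => /(_ erefl) E1.
  have := imE (D (- D x)); rewrite D3 => /(_ erefl) E2.
  rewrite xE; move: (x + D (D x)) (D (- D x)) E1 E2 => a b E1 E2.
  by rewrite !linearD /=; vlra.
(* On im D put A = K^2 and A' = -M, the conjugate of A by D. They commute, with A^2 + 3AA' = 4A and
   A'^2 + 3AA' = 4A', so joint eigenvalues could only be (0,0), (4,0), (0,4), (1,1). Eliminating M
   gives the quintic. *)
pose M y := D (K (K (D y))).
have Mim y : D (D (M y)) = - M y by rewrite /M D3.
have KKim y : D (D y) = - y -> D (D (K (K y))) = - K (K y).
  by move=> py; rewrite K_ker // K_im.
have KKKK y : D (D y) = - y ->
    K (K (K (K y))) - 3 *: K (K (M y)) = 4 *: K (K y).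
  by move=> py; have := congr1 K (im_eq py); rewrite !lin.
have KKM y : D (D y) = - y -> K (K (M y)) = M (K (K y)).
  move=> py; have E1 := KKKK y py; have E2 := ker_eq (K_im py).
  by rewrite -/(M _) in E2; vlra.
have MM y : D (D y) = - y -> 3 *: M (K (K y)) - M (M y) = 4 *: M y.
  move=> py; have := congr1 D (KKKK (D y) (D3 y)).
  rewrite /M !lin /= py !lin /= => E1.
  have E2 := congr1 D (congr1 K (congr1 K (KKim (D y) (D3 y)))).
  by rewrite !lin /= in E2; vlra.
split=> [{}x kx|y py].
  have py := K_ker kx; have E1 := ker_eq kx; rewrite -/(M _) in E1.
  have E2 := congr1 (K \o K) E1; have E3 := congr1 (D \o K \o K \o D) E1.
  have E4 := MM _ py; have E5 := KKM _ py.
  rewrite /= !lin /= -!/(M _) in E2 E3; vlra.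
have E1 := im_eq py; have E2 := congr1 K (KKKK y py).
have E3 := im_eq (Mim y); have E4 := congr1 K (MM y py).
have E5 := congr1 K (KKM y py).
rewrite -!/(M _) !lin /= in E1 E2 E3 E4 E5; vlra.
Qed.

End Rotation.


(** * Bilinearity of the bracket and eigenspaces *)

Section Bilinearity.
Context {F : fieldType} {g : lieAlgType F}.
Implicit Types x y z : g.

Lemma lieDl x y z : lie (x + y) z = lie x z + lie y z.
Proof. by rewrite -[x in LHS]scale1r lie_linearl scale1r. Qed.

Lemma lie0l x : lie 0 x = 0.
Proof. by rewrite lieC linear0 oppr0. Qed.

Lemma lieZl a x y : lie (a *: x) y = a *: lie x y.
Proof. by rewrite -[a *: x]addr0 lie_linearl lie0l addr0. Qed.

Lemma lieNl x y : lie (- x) y = - lie x y.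
Proof. by rewrite -scaleN1r lieZl scaleN1r. Qed.

Lemma lieBl x y z : lie (x - y) z = lie x z - lie y z.
Proof. by rewrite lieDl lieNl. Qed.

Lemma lieDr x y z : lie x (y + z) = lie x y + lie x z.
Proof. exact: linearD. Qed.

Lemma lieBr x y z : lie x (y - z) = lie x y - lie x z.
Proof. exact: linearB. Qed.

Lemma lieNr x y : lie x (- y) = - lie x y.
Proof. exact: linearN. Qed.

Lemma lieZr a x y : lie x (a *: y) = a *: lie x y.
Proof. exact: linearZ. Qed.

Lemma lie0r x : lie x 0 = 0.
Proof. exact: linear0. Qed.

Definition lie_bilinear :=
  (lieDl, lieBl, lieNl, lieZl, lie0l, lieDr, lieBr, lieNr, lieZr, lie0r).

Lemma eigspP (a : F) x y : reflect (lie x y = a *: y) (y \in eigsp a x).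
Proof.
rewrite memv_ker add_lfunE opp_lfunE scale_lfunE id_lfunE adE subr_eq0.
exact: eqP.
Qed.

End Bilinearity.

(** * Euler elements and sl2-triples in a simple algebra *)

Section Sl2Action.
Context {R : realFieldType} {g : lieAlgType R}.

(** Put z = a + p + m. The weight -1 part of z^3 x = -z x reads 3 a m^2 x = 0, and p^2 maps m^2 x to
    x/4 while commuting with a. *)
Lemma centralizer_kills_weight1 (h p m a x : g) :
  lie h p = p -> lie h m = - m -> lie p m = - 2^-1 *: h ->
  lie a p = 0 -> lie a m = 0 ->
  (forall y, lie h (lie h (lie h y)) = lie h y) ->
  (forall y, lie (a + p + m) (lie (a + p + m) (lie (a + p + m) y))
     = - lie (a + p + m) y) ->
  lie h x = x -> lie a x = 0.
Proof.
move=> hp hm pm ap am h3 z3 hx.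
have pa y : lie p (lie a y) = lie a (lie p y).
  by rewrite [RHS]lie_jacobir ap lie0l add0r.
have ma y : lie m (lie a y) = lie a (lie m y).
  by rewrite [RHS]lie_jacobir am lie0l add0r.
have px : lie p x = 0.
  have E : lie h (lie p x) = 2 *: lie p x.
    by rewrite lie_jacobir hp hx scaler_nat.
  by have := h3 (lie p x); rewrite !(E, lieZr) => {}E; vlra.
set y := lie m x; set v := lie m y.
have hy : lie h y = 0 by rewrite lie_jacobir hm hx lieNl addNr.
have py : lie p y = - 2^-1 *: x.
  by rewrite lie_jacobir pm px lieZl hx lie0r addr0.
have pv : lie p v = - 2^-1 *: y.
  by rewrite lie_jacobir pm py lieZl hy lieZr scaler0 add0r.
have hv : lie h v = - v by rewrite lie_jacobir hm hy lieNl lie0r addr0.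
have mv : lie m v = 0.
  have E : lie h (lie m v) = - 2 *: lie m v.
    by rewrite lie_jacobir hm hv lieNl lieNr scaleNr scaler_nat opprD.
  by have := h3 (lie m v); rewrite !(E, lieZr) => {}E; vlra.
have := congr1 (fun t => lie p (lie p t)) (z3 x).
have my : lie m y = v by []. have mx : lie m x = y by [].
clearbody v y.
rewrite !(lie_bilinear, px, mx, py, my, pv, mv, pa, ma) => E; vlra.
Qed.

Lemma simple_center0 (y : g) :
  simple_lie g -> (forall x, lie x y = 0) -> y = 0.
Proof.
move=> [[a [b ab0]] simple] yC.
have [|Z0|ZT] := simple (centv fullv).
- move=> x t /centvP tC; rewrite tC ?memvf //; exact: mem0v.
- by apply/eqP; rewrite -memv0 -Z0; apply/centvP.
- case/eqP: ab0; have /centvP -> // : b \in centv fullv by rewrite ZT memvf.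
  exact: memvf.
Qed.

(* The elements of g_0(h) that centralize g_1(h) and g_(-1)(h) form an ideal. *)
Lemma simple_euler_faithful (h y : g) :
  simple_lie g -> h != 0 ->
  (forall x, lie h (lie h (lie h x)) = lie h x) ->
  lie h y = 0 -> (forall x, lie y (lie h x) = 0) -> y = 0.
Proof.
move=> simple hn0 h3 hy yhx.
pose T := (lker (ad h) :&: centv (limg (ad h)))%VS.
have TP t : reflect (lie h t = 0 /\ forall x, lie t (lie h x) = 0) (t \in T).
  apply: (iffP idP) => [|[ht thx]].
    rewrite memv_cap memv_ker adE => /andP [/eqP ht /centvP tC].
    split=> // x; rewrite lieC tC ?oppr0 // -adE; exact: memv_img (memvf x).
  rewrite memv_cap memv_ker adE ht eqxx; apply/centvP => _ /memv_imgP [x _ ->].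
  by rewrite adE lieC thx oppr0.
case: (simple) => _ /(_ T) [|T0|TT].
- move=> x t /TP [ht thx]; apply/TP.
  (* Since t kills the image of ad h, x may be replaced by its weight 0 part. *)
  have xt : lie x t = lie (x - lie h (lie h x)) t.
    by rewrite lieBl [lie (lie h _) t]lieC thx oppr0 subr0.
  have hx0 : lie h (x - lie h (lie h x)) = 0 by rewrite lieBr h3 subrr.
  rewrite xt; move: (x - _) hx0 => x0 hx0; split.
    by rewrite lie_jacobir hx0 ht lie0l lie0r addr0.
  move=> u; apply/eqP; rewrite -(addr0 (lie _ _)) -(lie0r x0) -(thx u).
  rewrite -subr_eq0; apply/eqP.
  have E1 := lie_jacobir x0 t (lie h u); have E2 := lie_jacobir x0 h u.
  rewrite [lie x0 h]lieC hx0 oppr0 lie0l add0r in E2.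
  by rewrite thx lie0r E2 thx addr0 in E1; rewrite -E1 thx !lie0r; vlra.
- by apply/eqP; rewrite -memv0 -T0; apply/TP.
- case/eqP: hn0; apply: simple_center0 => // x.
  have /TP [hx _] : x \in T by rewrite TT memvf.
  by rewrite lieC hx oppr0.
Qed.

Lemma simple_euler_sl2 (h z : g) :
  simple_lie g -> h != 0 ->
  (forall x, lie h (lie h (lie h x)) = lie h x) ->
  (forall x, lie z (lie z (lie z x)) = - lie z x) ->
  lie z (lie z h) = - h -> lie h (lie h z) = z.
Proof.
move=> simple hn0 h3 z3 zzh.
(* z' is the part of z of h-weights 1 and -1, and a the part of weight 0. Splitting [z, w] = h by
   weights shows that a commutes with z' and w. *)
set w := lie h z; set z' := lie h w; pose a := z - z'.
have hz' : lie h z' = w by rewrite /z' /w h3.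
have ha : lie h a = 0 by rewrite /a lieBr hz' subrr.
have zE : z = a + z' by rewrite /a subrK.
have zw : lie z w = h by rewrite /w [lie h z]lieC lieNr zzh opprK.
have awz : lie a w + lie z' w = h by rewrite -lieDl -zE.
have hzw : lie h (lie z' w) = 0 by rewrite lie_jacobir hz' -/z' !liexx addr0.
have haw : lie h (lie a w) = lie a z' by rewrite lie_jacobir ha lie0l add0r.
have haz : lie h (lie a z') = lie a w.
  by rewrite lie_jacobir ha lie0l add0r hz'.
have az' : lie a z' = 0.
  by rewrite -haw -[RHS](liexx h) -[X in _ = lie h X]awz lieDr hzw addr0.
have aw : lie a w = 0 by rewrite -haz az' lie0r.
have z'w : lie z' w = h by rewrite -awz aw add0r.
have -> // : z' = z.
suff a0 : a = 0 by rewrite zE a0 add0r.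
apply: (simple_euler_faithful simple hn0 h3 ha) => x.
pose p := 2^-1 *: (z' + w); pose m := 2^-1 *: (z' - w).
have zpm : z = a + p + m by rewrite /p /m {1}zE; vlra.
have zmp : z = a + m + p by rewrite zpm addrAC.
have hp : lie h p = p by rewrite /p lieZr lieDr hz' -/z' addrC.
have hm : lie h m = - m by rewrite /m lieZr lieBr hz' -/z' -scalerN opprB.
have pm : lie p m = - 2^-1 *: h.
  by rewrite /p /m !lie_bilinear !liexx [lie w z']lieC z'w; vlra.
have ap : lie a p = 0 by rewrite /p lieZr lieDr az' aw addr0 scaler0.
have am : lie a m = 0 by rewrite /m lieZr lieBr az' aw subr0 scaler0.
have kill1 : forall x, lie h x = x -> lie a x = 0.
  by move=> t; apply: (@centralizer_kills_weight1 h p m); rewrite -?zpm.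
have kill2 : forall x, lie h x = - x -> lie a x = 0.
  (* Weight -1 for h is weight 1 for -h, with p and m exchanged. *)
  move=> t ht; apply: (@centralizer_kills_weight1 (- h) m p); rewrite -?zmp //.
  - by rewrite lieNl hm opprK.
  - by rewrite lieNl hp.
  - by rewrite [LHS]lieC pm scalerN.
  - by move=> u; rewrite !(lieNl, lieNr) !opprK h3.
  - by rewrite lieNl ht opprK.
have -> : lie h x = 2^-1 *: (lie h (lie h x) + lie h x)
    - 2^-1 *: (lie h (lie h x) - lie h x) by vlra.
by rewrite lieBr !lieZr kill1 ?kill2 ?scaler0 ?subr0 // !lie_bilinear h3; vlra.
Qed.

(* On the vectors where z acts with square -1/4, z and h anticommute. *)
Lemma euler_half_weights (U : {vspace g}) (h z : g) :
  lie h (lie h z) = z -> lie z (lie z h) = - h ->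
  (forall x, x \in U -> lie h x \in U) ->
  (forall x, x \in U -> lie z x \in U) ->
  (forall x, x \in U -> lie z (lie z x) = - 4^-1 *: x) ->
  forall x, x \in U -> lie h (lie h x) = 4^-1 *: x.
Proof.
move=> hhz zzh hU zU zzU.
set w := lie h z in hhz; have zw : lie z w = h.
  by rewrite /w [lie h z]lieC lieNr zzh opprK.
have wE x : lie w x = lie h (lie z x) - lie z (lie h x).
  by rewrite lie_jacobir addrK.
have hE x : lie h x = lie z (lie w x) - lie w (lie z x).
  by rewrite -[in LHS]zw lie_jacobir addrK.
have zE x : lie z x = lie h (lie w x) - lie w (lie h x).
  by rewrite -[in LHS]hhz lie_jacobir addrK.
(* With w = hz - zh as operators, h = zw - wz becomes h = 2zhz + h/2 because z^2 = -1/4. *)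
have hzhz x : x \in U -> lie h x = 4 *: lie z (lie h (lie z x)).
  move=> xU; have := hE x; rewrite !wE !lie_bilinear !zzU ?hU // lieZr; vlra.
have zh x : x \in U -> lie z (lie h x) = - lie h (lie z x).
  by move=> xU; rewrite hzhz // lieZr zzU ?hU ?zU //; vlra.
have wU x : x \in U -> lie w x = 2 *: lie h (lie z x).
  by move=> xU; rewrite wE zh //; vlra.
move=> x xU; have := zE (lie z x).
by rewrite !wU ?hU ?zU // zh ?zU // zzU // !lie_bilinear; vlra.
Qed.

End Sl2Action.


(** * Weight decomposition under H and the action of H/2 + c *)

(** The components are the Lagrange interpolation polynomials at -2, ..., 2 applied to K. Being
    polynomials in K, they preserve every K-stable subspace containing x. *)
Lemma quintic_components (R : realFieldType) (V : vectType R)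
    (K : {linear V -> V}) (x : V) :
  (forall y, K (K (K (K (K y)))) = 5 *: K (K (K y)) - 4 *: K y) ->
  exists xm2 xm1 x0 x1 x2,
    [/\ x = xm2 + xm1 + (x0 + x1 + x2),
        K xm2 = - 2 *: xm2 /\ K xm1 = - xm1,
        [/\ K x0 = 0, K x1 = x1 & K x2 = 2 *: x2] &
        forall U : {vspace V}, (forall y, y \in U -> K y \in U) -> x \in U ->
          xm2 \in U /\ xm1 \in U].
Proof.
move=> K5; have := K5 x.
set x1 := K x; set x2 := K x1; set x3 := K x2; set x4 := K x3.
have [K0 K1 K2 K3] : [/\ K x = x1, K x1 = x2, K x2 = x3 & K x3 = x4] by [].
clearbody x4 x3 x2 x1 => K4.
exists (24^-1 *: (x4 - 2 *: x3 - x2 + 2 *: x1)).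
exists (- 6^-1 *: (x4 - x3 - 4 *: x2 + 4 *: x1)).
exists (4^-1 *: (x4 - 5 *: x2 + 4 *: x)).
exists (- 6^-1 *: (x4 + x3 - 4 *: x2 - 4 *: x1)).
exists (24^-1 *: (x4 + 2 *: x3 - x2 - 2 *: x1)).
have [KD KN KZ] : [/\ forall y z, K (y + z) = K y + K z,
    forall y, K (- y) = - K y & forall a y, K (a *: y) = a *: K y].
  by split=> *; rewrite ?linearD ?linearN ?linearZ.
rewrite !(KD, KN, KZ) K0 K1 K2 K3 K4.
split; [by vlra | by split; vlra | by split; vlra |].
move=> U KU xU; have x1U : x1 \in U by rewrite -K0 KU.
have x2U : x2 \in U by rewrite -K1 KU.
have x3U : x3 \in U by rewrite -K2 KU.
have x4U : x4 \in U by rewrite -K3 KU.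
by split; do ![apply: rpredD | rewrite rpredN | apply: rpredZ].
Qed.

Section Weights.
Context {R : realFieldType} {g : lieAlgType R}.

Section HalfWeight.
Context (e f H z x : g).
Hypotheses (He : lie H e = 2 *: e) (Hf : lie H f = - 2 *: f).
Hypotheses (ef : lie e f = H) (ez : lie e z = 0) (fz : lie f z = 0).
Hypothesis H3 : forall y, lie H y = 3 *: y -> y = 0.
Hypothesis HN3 : forall y, lie H y = - 3 *: y -> y = 0.
Hypothesis D3 : let D := z + 2^-1 *: (e - f) in
  forall y, lie D (lie D (lie D y)) = - lie D y.

(** Absence of weights 3 and -3 leaves only x and y = [f, x] in the sl2-string. There u = (e - f)/2
    has square -1/4 and commutes with z, so the u-part of (z + u)^3 = -(z + u) is 3z^2 - 1/4 =
    -1. *)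
Lemma weight1_quarter : lie H x = x -> lie z (lie z x) = - 4^-1 *: x.
Proof.
move=> Hx.
have ezE y : lie e (lie z y) = lie z (lie e y).
  by rewrite lie_jacobir ez lie0l add0r.
have fzE y : lie f (lie z y) = lie z (lie f y).
  by rewrite lie_jacobir fz lie0l add0r.
have ex : lie e x = 0.
  by apply: H3; rewrite lie_jacobir He Hx lieZl; vlra.
set y := lie f x.
have Hy : lie H y = - y by rewrite lie_jacobir Hf Hx lieZl -/y; vlra.
have ey : lie e y = x by rewrite lie_jacobir ef Hx ex lie0r addr0.
have fy : lie f y = 0.
  by apply: HN3; rewrite lie_jacobir Hf Hy lieZl lieNr; vlra.
have fx : lie f x = y by [].
clearbody y; move: D3 => /= /(_ x); set D := z + _.
have DzE t : lie D (lie z t) = lie z (lie D t).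
  by rewrite /D !(lieDl, lieZl, lieNl) ezE fzE !(lieDr, lieZr, lieNr).
have Dx : lie D x = lie z x - 2^-1 *: y.
  by rewrite !lieDl lieZl lieBl ex fx sub0r scalerN.
have Dy : lie D y = lie z y + 2^-1 *: x.
  by rewrite !lieDl lieZl lieBl ey fy subr0.
clearbody D; rewrite !(Dx, Dy, DzE, lieDr, lieNr, lieZr) => E.
(* Applying e kills the x-part and turns y into x, which isolates the u-part. *)
have {E} := congr1 (lie e) E.
by rewrite !(lieDr, lieBr, lieNr, lieZr, ezE, ex, ey, lie0r); vlra.
Qed.

End HalfWeight.

Section EulerSum.
Context (e f H z c : g).
Let u := 2^-1 *: (e - f).
Let D := z + u.
Hypotheses (He : lie H e = 2 *: e) (Hf : lie H f = - 2 *: f).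
Hypotheses (ef : lie e f = H) (ez : lie e z = 0) (fz : lie f z = 0).
Hypotheses (ec : lie e c = 0) (fc : lie f c = 0).
Hypothesis D3 : forall y, lie D (lie D (lie D y)) = - lie D y.
Hypothesis c3 : forall y, lie e y = 0 -> lie f y = 0 ->
  lie c (lie c (lie c y)) = lie c y.
Hypotheses (ccz : lie c (lie c z) = z) (zzc : lie z (lie z c) = - c).
Hypothesis dim2 : \dim (eigsp 2 H) = 1%N.
Hypothesis dimN2 : \dim (eigsp (-2) H) = 1%N.

Lemma cent_H y : lie e y = 0 -> lie f y = 0 -> lie H y = 0.
Proof.
move=> ey fy; have := lie_jacobir e f y.
by rewrite ef fy ey !lie0r addr0 => <-.
Qed.

Lemma sl2_quintic x :
  lie H (lie H (lie H (lie H (lie H x)))) = 5 *: lie H (lie H (lie H x)) -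
  4 *: lie H x.
Proof.
have fe : lie f e = - H by rewrite lieC ef.
have zH : lie z H = 0 by rewrite lieC cent_H ?oppr0.
have ze : lie z e = 0 by rewrite lieC ez oppr0.
have zf : lie z f = 0 by rewrite lieC fz oppr0.
have eH : lie e H = - 2 *: e by rewrite lieC He scaleNr.
have fH : lie f H = 2 *: f by rewrite lieC Hf scaleNr opprK.
have comm a b y : lie a (lie b y) - lie b (lie a y) = lie (lie a b) y.
  by rewrite (lie_jacobir a) addrK.
apply: (@rotation_quintic _ _ (lie D) (lie H) (lie (e + f)) (lie u) D3).
- move=> y; rewrite comm -lieNl; congr lie.
  by rewrite /D /u !lie_bilinear zH eH fH; vlra.
- move=> y; rewrite comm; congr lie.
  by rewrite /D /u !lie_bilinear !liexx ze zf ef fe; vlra.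
- move=> y; rewrite comm -lieZl; congr lie.
  by rewrite /u !lie_bilinear He Hf; vlra.
- move=> y; rewrite comm -lieNl; congr lie.
  by rewrite /u !lie_bilinear eH fH; vlra.
Qed.

Let no_weight k y : k * (k * (k * (k * k))) - 5 * (k * (k * k)) + 4 * k != 0 ->
  lie H y = k *: y -> y = 0.
Proof.
move=> k0 Hy; have := sl2_quintic y; rewrite !(Hy, lieZr) !scalerA => E.
have /eqP : (k * (k * (k * (k * k))) - 5 * (k * (k * k)) + 4 * k) *: y = 0.
  move: E; rewrite scalerDl scalerBl !mulrA => E; vlra.
by rewrite scaler_eq0 (negPf k0) => /eqP.
Qed.

(** k^5 - 5k^3 + 4k takes the values 120, -120 and 720 here. Excluding 3 and -3 bounds the
    sl2-strings; excluding 3 and 4 closes the Borel-type sum under brackets. *)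
Lemma no_weight34 (k : R) y : k \in [:: 3; -3; 4] -> lie H y = k *: y -> y = 0.
Proof.
rewrite !inE => kE; apply: no_weight.
by case/or3P: kE => /eqP ->; apply/eqP; lra.
Qed.

Let h := 2^-1 *: H + c.

Let cH : lie c H = 0. Proof. by rewrite lieC cent_H ?oppr0. Qed.

Let hE y k : lie H y = k *: y -> lie h y = (2^-1 * k) *: y + lie c y.
Proof. by move=> Hy; rewrite lieDl lieZl Hy scalerA. Qed.

Let e_neq0 : e != 0.
Proof.
apply: contra_eq_neq dim2 => e0; have H0 : H = 0 by rewrite -ef e0 lie0l.
suff -> : eigsp 2 H = 0%VS by rewrite dimv0.
apply/eqP; rewrite -subv0; apply/subvP => y /eigspP.
by rewrite H0 lie0l memv0 => E; apply/eqP; vlra.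
Qed.

Let f_neq0 : f != 0.
Proof.
apply: contra_eq_neq dimN2 => f0; have H0 : H = 0 by rewrite -ef f0 lie0r.
suff -> : eigsp (-2) H = 0%VS by rewrite dimv0.
apply/eqP; rewrite -subv0; apply/subvP => y /eigspP.
by rewrite H0 lie0l memv0 => E; apply/eqP; vlra.
Qed.

Let line (k : R) v y : \dim (eigsp k H) = 1%N -> v != 0 ->
  lie H v = k *: v -> lie H y = k *: y -> exists a, y = a *: v.
Proof.
move=> dk v0 Hv Hy; apply/vlineP.
have /eqP -> : <[v]>%VS == eigsp k H.
  by rewrite eqEdim dk dim_vline v0 andbT -memvE; apply/eigspP.
exact/eigspP.
Qed.

Lemma euler_weight2 y : lie H y = 2 *: y -> lie h y = y.
Proof.
move=> Hy; have [a ya] := line dim2 e_neq0 He Hy.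
by rewrite (hE Hy) ya lieZr [lie c e]lieC ec; vlra.
Qed.

Lemma euler_weightN2 y : lie H y = - 2 *: y -> lie h y = - y.
Proof.
move=> Hy; have [a ya] := line dimN2 f_neq0 Hf Hy.
by rewrite (hE Hy) ya lieZr [lie c f]lieC fc; vlra.
Qed.

(** [e, y] lies in g_2(H), the line of e, so a multiple of H corrects y to commute with e; commuting
    with f then follows. *)
Lemma weight0_split y : lie H y = 0 ->
  exists a t, [/\ y = a *: H + t, lie e t = 0 & lie f t = 0].
Proof.
move=> Hy; have [|a ya] := @line 2 e (lie e y) dim2 e_neq0 He.
  by rewrite lie_jacobir He Hy lieZl lie0r addr0.
(* The factor -1/2 comes from [e, H] = -2e. *)
exists (- 2^-1 * a), (y - (- 2^-1 * a) *: H).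
have et : lie e (y - (- 2^-1 * a) *: H) = 0.
  by rewrite lieBr ya lieZr [lie e H]lieC He; vlra.
split=> //; first by rewrite addrC subrK.
have : lie H (y - (- 2^-1 * a) *: H) = 0.
  by rewrite lieBr lieZr liexx Hy scaler0 subr0.
move: (y - _) et => t et Ht.
have [|b tb] := @line (-2) f (lie f t) dimN2 f_neq0 Hf.
  by rewrite lie_jacobir Hf Ht lieZl lie0r addr0.
(* Since [f, t] = b f, this bracket is b H, which forces b = 0. *)
have : lie e (lie f t) = 0 by rewrite lie_jacobir ef Ht et lie0r addr0.
rewrite tb lieZr ef => /eqP; rewrite scaler_eq0 => /orP [/eqP ->|/eqP H0].
  exact: scale0r.
by case/eqP: e_neq0; move: He; rewrite H0 lie0l => E; vlra.
Qed.

(** h kills H and acts as c on the centralizer of e and f, where c satisfies the cubic identity. *)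
Lemma euler_weight0 y : lie H y = 0 -> lie h (lie h (lie h y)) = lie h y.
Proof.
move=> /weight0_split [a [t [-> et ft]]].
have hcE s : lie e s = 0 -> lie f s = 0 -> lie h s = lie c s.
  by move=> es fs; rewrite lieDl lieZl cent_H // scaler0 add0r.
have cent s : lie e s = 0 -> lie f s = 0 ->
    lie e (lie c s) = 0 /\ lie f (lie c s) = 0.
  move=> es fs; rewrite (lie_jacobir e) (lie_jacobir f) ec fc es fs.
    by rewrite !lie0l !lie0r !addr0.
have hH : lie h H = 0 by rewrite lieDl lieZl liexx cH scaler0 addr0.
have [ect fct] := cent _ et ft; have [ecct fcct] := cent _ ect fct.
by rewrite !(lieDr _ (_ *: _)) !lieZr hH !(scaler0, add0r) !hcE // c3.
Qed.

Let half_weight k :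
  (forall x, lie H x = k *: x -> lie z (lie z x) = - 4^-1 *: x) ->
  forall x, lie H x = k *: x -> lie c (lie c x) = 4^-1 *: x.
Proof.
move=> zz x Hx; apply: (@euler_half_weights _ _ (eigsp k H) c z) => //.
- move=> t /eigspP Ht; apply/eigspP.
  by rewrite lie_jacobir cent_H // lie0l Ht lieZr add0r.
- move=> t /eigspP Ht; apply/eigspP.
  by rewrite lie_jacobir cent_H // lie0l Ht lieZr add0r.
- by move=> t /eigspP; apply: zz.
- exact/eigspP.
Qed.

(** Here h = 1/2 + c with c^2 = 1/4, so h^2 = h. *)
Lemma euler_weight1 y : lie H y = y -> lie h (lie h y) = lie h y.
Proof.
move=> Hy; have Hy1 : lie H y = 1 *: y by rewrite scale1r.
have cc : lie c (lie c y) = 4^-1 *: y.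
  apply: (@half_weight 1) => // t; rewrite scale1r.
  apply: (@weight1_quarter e f) => // s; apply: no_weight34;
    by rewrite !inE eqxx ?orbT.
have Hcy : lie H (lie c y) = 1 *: lie c y.
  by rewrite lie_jacobir cent_H // lie0l Hy scale1r add0r.
by rewrite (hE Hy1) lieDr lieZr (hE Hy1) (hE Hcy) cc; vlra.
Qed.

Lemma euler_weightN1 y : lie H y = - y -> lie h (lie h y) = - lie h y.
Proof.
move=> Hy; have Hy1 : lie H y = - 1 *: y by rewrite scaleN1r.
have cc : lie c (lie c y) = 4^-1 *: y.
  apply: (@half_weight (-1)) => // t; rewrite scaleN1r => Ht.
  (* The triple (-f, -e, -H) turns weight -1 into weight 1 and leaves [D] unchanged. *)
  apply: (@weight1_quarter (- f) (- e) (- H)).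
  - by rewrite !lie_bilinear Hf; vlra.
  - by rewrite !lie_bilinear He; vlra.
  - by rewrite !lie_bilinear lieC ef; vlra.
  - by rewrite lieNl fz oppr0.
  - by rewrite lieNl ez oppr0.
  - move=> s Hs; apply: (@no_weight34 (-3)); first by rewrite !inE eqxx ?orbT.
    by rewrite scaleNr -Hs lieNl opprK.
  - move=> s Hs; apply: (@no_weight34 3); first by rewrite !inE eqxx ?orbT.
    by move: Hs; rewrite lieNl scaleNr => /oppr_inj.
  - by move=> /= s; rewrite opprK [- f + e]addrC.
  - by rewrite lieNl Ht opprK.
have Hcy : lie H (lie c y) = - 1 *: lie c y.
  by rewrite lie_jacobir cent_H // lie0l Hy lieNr scaleN1r add0r.
by rewrite (hE Hy1) lieDr lieZr (hE Hy1) (hE Hcy) cc; vlra.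
Qed.

Lemma euler_sum x : lie h (lie h (lie h x)) = lie h x.
Proof.
have [xm2 [xm1 [x0 [x1 [x2 [-> [E1 E2] [E3 E4 E5] _]]]]]] :=
  quintic_components x sl2_quintic.
rewrite !lieDr !(euler_weight2 E5) !(euler_weightN2 E1, lieNr).
by rewrite (euler_weight0 E3) !(euler_weight1 E4) !(euler_weightN1 E2, lieNr)
  !opprK.
Qed.

(** H commutes with h, so the H-components of x of weights -2 and -1 are again fixed by h; but h =
    -1 on the first and h^2 = -h on the second, so both vanish. *)
Lemma euler_sum1_sub x : lie h x = x ->
  x \in (eigsp 0 H + eigsp 1 H + eigsp 2 H)%VS.
Proof.
move=> hx; have [xm2 [xm1 [x0 [x1 [x2 [xE [E1 E2] [E3 E4 E5] stab]]]]]] :=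
  quintic_components x sl2_quintic.
have [||/eigspP] := stab (eigsp 1 h).
- move=> y /eigspP hy; apply/eigspP; rewrite lie_jacobir hy lieZr.
  by rewrite lieDl lieZl liexx cH scaler0 addr0 lie0l add0r.
- by apply/eigspP; rewrite scale1r.
rewrite euler_weightN2 // => F1 /eigspP F2.
have := euler_weightN1 E2; rewrite !(F2, lieZr) => F3.
have {}F1 : xm2 = 0 by vlra.
have {}F3 : xm1 = 0 by clear F1; vlra.
rewrite xE F1 F3 !add0r !memv_add //; apply/eigspP => //.
- by rewrite scale0r.
- by rewrite scale1r.
Qed.

Lemma euler_sum_borel : h \in (eigsp 0 H + eigsp 1 H + eigsp 2 H)%VS.
Proof.
rewrite -[h]addr0 -[h + 0]addr0 !memv_add ?mem0v //; apply/eigspP.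
by rewrite scale0r lieDr lieZr liexx cent_H // scaler0 addr0.
Qed.

Lemma borel_closed : lie_closed (eigsp 0 H + eigsp 1 H + eigsp 2 H)%VS.
Proof.
have bracket a b x y : lie H x = a *: x -> lie H y = b *: y ->
    lie H (lie x y) = (a + b) *: lie x y.
  by move=> Hx Hy; rewrite lie_jacobir Hx Hy lieZl lieZr scalerDl.
have in0 x : lie H x = 0 *: x -> x \in (eigsp 0 H + eigsp 1 H + eigsp 2 H)%VS.
  by move=> /eigspP; apply/subvP; rewrite -addvA addvSl.
have in1 x : lie H x = 1 *: x -> x \in (eigsp 0 H + eigsp 1 H + eigsp 2 H)%VS.
  by move=> /eigspP; apply/subvP/(subv_trans (addvSr _ _))/addvSl.
have in2 x : lie H x = 2 *: x -> x \in (eigsp 0 H + eigsp 1 H + eigsp 2 H)%VS.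
  by move=> /eigspP; apply/subvP; rewrite addvSr.
move=> _ _ /memv_addP [_ /memv_addP [x0 /eigspP X0 [x1 /eigspP X1 ->]]
  [x2 /eigspP X2 ->]] /memv_addP [_ /memv_addP [y0 /eigspP Y0
  [y1 /eigspP Y1 ->]] [y2 /eigspP Y2 ->]].
have two : 1 + 1 = 2 :> R by ring.
have B00 := bracket _ _ _ _ X0 Y0; have B01 := bracket _ _ _ _ X0 Y1.
have B02 := bracket _ _ _ _ X0 Y2; have B10 := bracket _ _ _ _ X1 Y0.
have B20 := bracket _ _ _ _ X2 Y0; have B11 := bracket _ _ _ _ X1 Y1.
have B12 := bracket _ _ _ _ X1 Y2; have B21 := bracket _ _ _ _ X2 Y1.
have B22 := bracket _ _ _ _ X2 Y2.
rewrite ?add0r ?addr0 two in B00 B01 B02 B10 B20 B11.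
have {}B12 : lie x1 y2 = 0.
  by apply: (no_weight34 _ B12); rewrite !inE; apply/orP; left; apply/eqP; ring.
have {}B21 : lie x2 y1 = 0.
  by apply: (no_weight34 _ B21); rewrite !inE; apply/orP; left; apply/eqP; ring.
have {}B22 : lie x2 y2 = 0.
  apply: (no_weight34 _ B22); rewrite !inE; apply/orP; right; apply/orP; right.
  by apply/eqP; ring.
rewrite !lieDl !lieDr B12 B21 B22 !addr0.
by do ![apply: rpredD]; solve [exact: in0 | exact: in1 | exact: in2].
Qed.

End EulerSum.
End Weights.


(** * The standard basis of sl2 *)

Lemma mx22_lie (F : fieldType) (a b c d a' b' c' d' : F) :
  lie (mx22 a b c d) (mx22 a' b' c' d') =
  mx22 (b * c' - b' * c) (a * b' + b * d' - a' * b - b' * d)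
       (c * a' + d * c' - c' * a - d' * c) (c * b' - c' * b).
Proof.
apply/matrixP => i j; rewrite /lie /= /mx_lie !mxE !big_ord_recl !big_ord0 !mxE.
by case: i => [[|[|//]] ?]; case: j => [[|[|//]] ?]; rewrite /=; ring.
Qed.

Lemma mx22_scale (F : fieldType) (k a b c d : F) :
  k *: mx22 a b c d = mx22 (k * a) (k * b) (k * c) (k * d).
Proof.
apply/matrixP => i j; rewrite !mxE.
by case: i => [[|[|//]] ?]; case: j => [[|[|//]] ?].
Qed.

Lemma mx22_add (F : fieldType) (a b c d a' b' c' d' : F) :
  mx22 a b c d + mx22 a' b' c' d' = mx22 (a + a') (b + b') (c + c') (d + d').
Proof.
apply/matrixP => i j; rewrite !mxE.
by case: i => [[|[|//]] ?]; case: j => [[|[|//]] ?].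
Qed.

Fact sl2_X_proof (F : fieldType) : mx22 0 1 0 0 \in sl2 F.
Proof. by rewrite sl2P /mxtrace !big_ord_recl big_ord0 !mxE /= !addr0. Qed.

Fact sl2_Y_proof (F : fieldType) : mx22 0 0 1 0 \in sl2 F.
Proof. by rewrite sl2P /mxtrace !big_ord_recl big_ord0 !mxE /= !addr0. Qed.

Definition sl2_X (F : fieldType) : subvs_of (sl2 F) := Subvs (sl2_X_proof F).
Definition sl2_Y (F : fieldType) : subvs_of (sl2 F) := Subvs (sl2_Y_proof F).

Lemma sl2_HX (F : fieldType) : lie (sl2_H F) (sl2_X F) = 2 *: sl2_X F.
Proof.
by apply: val_inj; rewrite linearZ /= mx22_lie mx22_scale; congr mx22; ring.
Qed.

Lemma sl2_HY (F : fieldType) : lie (sl2_H F) (sl2_Y F) = - 2 *: sl2_Y F.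
Proof.
by apply: val_inj; rewrite linearZ /= mx22_lie mx22_scale; congr mx22; ring.
Qed.

Lemma sl2_XY (F : fieldType) : lie (sl2_X F) (sl2_Y F) = sl2_H F.
Proof. by apply: val_inj; rewrite /= mx22_lie; congr mx22; ring. Qed.

Lemma sl2_UE (F : fieldType) : sl2_U F = sl2_X F - sl2_Y F.
Proof.
apply: val_inj; rewrite -scaleN1r linearD linearZ /= mx22_scale mx22_add.
by congr mx22; ring.
Qed.

Lemma sl2_span (F : fieldType) (A : subvs_of (sl2 F)) :
  exists a b c, A = a *: sl2_H F + b *: sl2_X F + c *: sl2_Y F.
Proof.
exists (vsval A 0 0), (vsval A 0 1), (vsval A 1 0).
apply: val_inj; rewrite !linearD !linearZ /= !mx22_scale !mx22_add.
have : \tr (vsval A) == 0 by rewrite -sl2P; exact: subvsP.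
rewrite /mxtrace !big_ord_recl big_ord0 addr0 addr_eq0 -eqr_oppLR => /eqP trA.
move: (vsval A) trA => M trM.
apply/matrixP => i j; rewrite !mxE !(mulr0, mulr1, addr0, add0r) mulrN1 {}trM.
have ME (k l : 'I_2) : i = k :> nat -> j = l :> nat -> M i j = M k l.
  by move=> ik jl; congr (M _ _); apply: val_inj.
by case: i j ME => [[|[|//]] ip] [[|[|//]] jp] ME /=; apply: ME.
Qed.

(** * The Cartan involution and the assembly of the theorem *)

Lemma antifixed_im (F : numFieldType) (g : lieAlgType F) (H0 : g)
    (theta : 'End(g)) :
  lie_hom theta -> (theta \o theta)%VF = \1%VF ->
  fixedSpace theta = lker (ad H0) ->
  (forall x, lie H0 x \in antifixed_sp theta) /\
  (forall x, x \in antifixed_sp theta -> lie H0 x = 0 -> x = 0).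
Proof.
move=> hom_theta theta2 fixE.
have fixP x : (theta x == x) = (lie H0 x == 0).
  by have := memv_ker (ad H0) x; rewrite adE -fixE => <-; apply/eqP/fixedSpaceP.
have antiP x : (x \in antifixed_sp theta) = (theta x + x == 0).
  by rewrite memv_ker add_lfunE id_lfunE.
have tH0 : theta H0 = H0 by apply/eqP; rewrite fixP liexx.
split=> x; rewrite antiP.
  (* theta x + x is fixed by theta, hence killed by ad H0. *)
  rewrite hom_theta tH0 -lieDr -fixP linearD /=.
  have /lfunP/(_ x) := theta2; rewrite comp_lfunE id_lfunE => ->.
  by rewrite addrC.
move=> anti /eqP; rewrite -fixP => /eqP tx; move: anti.
by rewrite tx -mulr2n -scaler_nat scaler_eq0 pnatr_eq0 /= => /eqP.
Qed.

Theorem theorem2p13 (R : realType) (g : lieAlgType R) (H0 : g)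
    (theta : 'End(g)) (kappa : 'Hom(subvs_of (sl2 R), g)) :
  hermitian_simple g -> tube_type g ->
  H_element H0 ->
  cartan_involution theta -> fixedSpace theta = lker (ad H0) ->
  H1_hom kappa (2^-1 *: sl2_U R) H0 ->
  multiplicity_one kappa ->
  let Hk := kappa (sl2_H R) in
  let bk := (eigsp 0 Hk + eigsp 1 Hk + eigsp 2 Hk)%VS in
  let gk := centralizer (limg kappa) in
  hermitian_simple (subvs_of gk) -> tube_type (subvs_of gk) ->
  forall hk : subvs_of gk,
  vsval hk \in antifixed_sp theta -> hk != 0 -> euler hk ->
  let h := 2^-1 *: Hk + vsval hk in
  [/\ h \in bk,
      euler h,
      exists (b : lie_subalgebra g) (hb : subvs_of b),
        [/\ (b : {vspace g}) = bk, vsval hb = h & euler hb],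
      eigsp 1 h = (eigsp 1 h :&: bk)%VS &
      h \in antifixed_sp theta].
Proof.
move=> _ _ /H_element_cube H0cube [hom_theta theta2 _] fixE [hom_k H0k].
move=> [dim2 dimN2] Hk bk gk [simple_gk _ _] _ hk hk_anti hk0 /eulerP hk3 h.
have [im_anti anti0] := antifixed_im hom_theta theta2 fixE.
pose e := kappa (sl2_X R); pose f := kappa (sl2_Y R).
pose u := 2^-1 *: (e - f); pose z := H0 - u.
have He : lie Hk e = 2 *: e by rewrite -hom_k sl2_HX linearZ.
have Hf : lie Hk f = - 2 *: f by rewrite -hom_k sl2_HY linearZ.
have ef : lie e f = Hk by rewrite -hom_k sl2_XY.
have uE : kappa (2^-1 *: sl2_U R) = u by rewrite sl2_UE linearZ linearB.
(* On the image of [kappa], ad H0 agrees with ad u by the (H_1) condition. *)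
have kz A : lie (kappa A) z = 0.
  have /lfunP/(_ A) := H0k; rewrite !comp_lfunE !adE => E.
  rewrite hom_k uE in E.
  by rewrite /z lieBr [lie _ H0]lieC -E [lie (kappa A) u]lieC subrr.
have gkP t : reflect (lie e t = 0 /\ lie f t = 0) (t \in gk).
  apply: (iffP (centvP _ _)) => [tC|[et ft] _ /memv_imgP [A _ ->]].
    by split; apply: tC; apply: memv_img; apply: memvf.
  have [a [b [c ->]]] := sl2_span A; rewrite !linearD !linearZ /=.
  by rewrite !lieDl !lieZl (cent_H ef et ft) et ft !scaler0 !addr0.
have zgk : z \in gk by apply/gkP; rewrite !kz.
have zuE : z + u = H0 by rewrite subrK.
have zE t : t \in gk -> lie z t = lie H0 t.
  move=> /gkP [et ft]; have ut : lie u t = 0.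
    by rewrite lieZl lieBl et ft subrr scaler0.
  by rewrite -zuE [RHS]lieDl ut addr0.
pose zk : subvs_of gk := Subvs zgk.
have zgk_stable t : t \in gk -> lie H0 t \in gk.
  by move=> tgk; rewrite -zE //; apply: lsvalP.
have zk3 x : lie zk (lie zk (lie zk x)) = - lie zk x.
  by apply: val_inj; rewrite linearN /= !zE ?zgk_stable ?subvsP.
(* ad H0 is injective on the -1 eigenspace of theta, so D^3 = -D improves to D^2 = -1 there. *)
have zzh : lie z (lie z (vsval hk)) = - vsval hk.
  rewrite !zE ?zgk_stable ?subvsP //; apply/eqP; rewrite -addr_eq0; apply/eqP.
  by apply: anti0; rewrite ?rpredD ?im_anti // lieDr H0cube addNr.
have zzhk : lie zk (lie zk hk) = - hk by apply: val_inj; rewrite linearN.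
have hhzk := simple_euler_sl2 simple_gk hk0 hk3 zk3 zzhk.
have hhz : lie (vsval hk) (lie (vsval hk) z) = z by have := congr1 vsval hhzk.
have [[ehk fhk] [ez fz]] := (gkP _ (subvsP hk), gkP _ zgk).
have D3 y : let D := z + u in lie D (lie D (lie D y)) = - lie D y.
  by rewrite /= zuE.
have c3 y : lie e y = 0 -> lie f y = 0 ->
    lie (vsval hk) (lie (vsval hk) (lie (vsval hk) y)) = lie (vsval hk) y.
  move=> ey fy; have ygk : y \in gk by apply/gkP.
  by have := congr1 vsval (hk3 (Subvs ygk)).
have h3 := euler_sum He Hf ef ez fz ehk fhk D3 c3 hhz zzh dim2 dimN2.
have sub1 := euler_sum1_sub He Hf ef ez fz ehk fhk D3 hhz zzh dimN2.
have hbk : h \in bk by apply: (euler_sum_borel ef ehk fhk).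
split=> //; first exact/eulerP.
- exists (LieSubalgebra (borel_closed He Hf ef ez fz D3)), (Subvs hbk).
  split=> //; apply/eulerP => x; apply: val_inj; exact: h3.
- apply/esym/capv_idPl/subvP => x /eigspP; rewrite scale1r; exact: sub1.
- rewrite rpredD // rpredZ //.
  (* This puts H_kappa in the image of ad H0, hence in the -1 eigenspace of theta. *)
  have -> : Hk = - lie H0 (lie H0 Hk).
    have H0E A : lie H0 (kappa A) = lie u (kappa A).
      by rewrite -zuE [LHS]lieDl [lie z _]lieC kz oppr0 add0r.
    have -> : lie H0 Hk = - (e + f).
      rewrite H0E lieZl lieBl [lie e _]lieC [lie f _]lieC He Hf; vlra.
    rewrite lieNr lieDr !H0E -/e -/f !lieZl !lieBl !liexx ef [lie f e]lieC ef.
    vlra.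
  by rewrite rpredN im_anti.
Qed.
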